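(* Let $A\in\mathbb{R}^{n\times d}$, $b\in\mathbb{R}^n$, and let $S\in\mathbb{R}^{m\times n}$ be an $\epsilon$-subspace embedding for the augmented matrix $(A\ \ b)\in\mathbb{R}^{n\times(d+1)}$ for some $0<\epsilon<1$. Let $SA=QR\hat V^T$ be a factorization of the form described in the context, with associated blocks $V_1\in\mathbb{R}^{d\times p}$ and $R_{11}\in\mathbb{R}^{p\times p}$, let $W=AV_1R_{11}^{-1}$ and let $y_*=\arg\min_{y\in\mathbb{R}^p}\|Wy-b\|_2$. If $y_\tau=y_*$, then $x_\tau:=V_1R_{11}^{-1}y_\tau$ is a solution of the linear least squares problem $\min_{x\in\mathbb{R}^d}\|Ax-b\|_2^2$.
   Context: Setting: $A\in\mathbb{R}^{n\times d}$ has rank $r$, with $n\ge d\ge r$. $\epsilon$-subspace embedding: $S\in\mathbb{R}^{m\times n}$ is an $\epsilon$-subspace embedding for $B\in\mathbb{R}^{n\times k}$ if $(1-\epsilon)\|y\|_2^2\le\|Sy\|_2^2\le(1+\epsilon)\|y\|_2^2$ for all $y\in\{Bz: z\in\mathbb{R}^k\}$. Factorization of the sketched matrix: $SA=QR\hat V^T$, where for some positive integer $p\le d$: - $R=\begin{pmatrix}R_{11}&R_{12}\\0&0\end{pmatrix}\in\mathbb{R}^{d\times d}$ with $R_{11}\in\mathbb{R}^{p\times p}$ nonsingular; - $Q=(Q_1\ \ Q_2)\in\mathbb{R}^{m\times d}$, where $Q_1\in\mathbb{R}^{m\times p}$ and $Q_2\in\mathbb{R}^{m\times(d-p)}$ have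 orthonormal columns; - $\hat V=(V_1\ \ V_2)\in\mathbb{R}^{d\times d}$ is orthogonal with $V_1\in\mathbb{R}^{d\times p}$. (In the paper's sketching algorithm, $y_\tau$ is the output of the iterative solver LSQR applied to $\min_y\|Wy-b\|_2$ and $x_\tau=V_1R_{11}^{-1}y_\tau$ is the returned vector; the hypothesis $y_\tau=y_*$ corresponds to relative tolerance $\tau_r=0$.) *)

(* Defs.v *)
From mathcomp Require Import all_boot all_order all_algebra reals.

Set Implicit Arguments.
Unset Strict Implicit.
Unset Printing Implicit Defensive.

Import Order.TTheory GRing.Theory Num.Theory.
Local Open Scope ring_scope.

(* The Euclidean norm; MathComp-Analysis' norm [`|v|] on matrices is the sup
   norm. *)
Definition norm2 (R : realType) (k : nat) (v : 'cV[R]_k) : R :=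
  Num.sqrt (\sum_(i < k) v i 0 ^+ 2).

Definition subspace_embedding (R : realType) (m n k : nat) (eps : R)
    (S : 'M[R]_(m, n)) (B : 'M[R]_(n, k)) : Prop :=
  forall y : 'cV[R]_n, (exists z : 'cV[R]_k, y = B *m z) ->
    (1 - eps) * norm2 y ^+ 2 <= norm2 (S *m y) ^+ 2 <=
    (1 + eps) * norm2 y ^+ 2.

Definition orthonormal_cols (R : realType) (m k : nat) (Q : 'M[R]_(m, k)) :
  Prop := Q^T *m Q = 1%:M.

(* The numbers of rows and columns are separate parameters because the matrix
   [row_mx V1 V2] below has the type ['M_(d, p + (d - p))], which is only
   propositionally square; hence both equations are required. *)
Definition orthogonal_mx (R : realType) (d k : nat) (V : 'M[R]_(d, k)) :
  Prop := V^T *m V = 1%:M /\ V *m V^T = 1%:M.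

(* [M = Q R V^T] with [Q = (Q1 Q2)], [R = (R11 R12; 0 0)] and [V = (V1 V2)].
   Each of the two blocks of [Q] has orthonormal columns, but no
   orthogonality between the columns of [Q1] and those of [Q2] is required. *)
Record rank_revealing_fact (R : realType) (m d p : nat) (M : 'M[R]_(m, d))
    (Q1 : 'M[R]_(m, p)) (Q2 : 'M[R]_(m, d - p))
    (R11 : 'M[R]_p) (R12 : 'M[R]_(p, d - p))
    (V1 : 'M[R]_(d, p)) (V2 : 'M[R]_(d, d - p)) : Prop := RankRevealingFact {
  fact_size : (0 < p <= d)%N;
  fact_R11 : R11 \in unitmx;
  fact_Q1 : orthonormal_cols Q1;
  fact_Q2 : orthonormal_cols Q2;
  fact_V : orthogonal_mx (row_mx V1 V2);
  fact_eq : M = row_mx Q1 Q2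
                *m block_mx R11 R12 (0 : 'M[R]_(d - p, p))
                                    (0 : 'M[R]_(d - p, d - p))
                *m (row_mx V1 V2)^T }.

Definition is_minimizer (R : realType) (T : Type) (f : T -> R) (x : T) : Prop :=
  forall z : T, f x <= f z.

(* Main.v *)
Require Import Defs.
From mathcomp Require Import all_boot all_order all_algebra reals.

Set Implicit Arguments.
Unset Strict Implicit.
Unset Printing Implicit Defensive.

Import Order.TTheory GRing.Theory Num.Theory.
Local Open Scope ring_scope.

(** The preconditioned problem loses nothing because [W = A V1 R11^-1] has the
    same range as [A].  The factorization collapses to
    [S A = Q1 (R11 R12) V^T], whose range is that of [Q1], and
    [P = V1 R11^-1] is a right inverse of the last two factors, so that
    [S A P = Q1].  Given [x], put [y = (R11 R12) V^T x]; then
    [S A x = Q1 y = S A (P y)].  An embedding with [eps < 1] cannot annihilate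
    a nonzero vector of the subspace it embeds ([subspace_embedding_eq0]), so
    the equality survives the removal of [S]: [A x = A P y = W y]
    ([sketched_range]).  Every residual [A x - b] is therefore a residual
    [W y - b], and the one attained at [y_star] is the residual of [A] at
    [P y_star]. *)

Lemma norm2_ge0 (R : realType) (k : nat) (v : 'cV[R]_k) : 0 <= norm2 v.
Proof. exact: sqrtr_ge0. Qed.

Lemma norm2_eq0 (R : realType) (k : nat) (v : 'cV[R]_k) :
  (norm2 v == 0) = (v == 0).
Proof.
have sq_ge0 (w : 'cV[R]_k) : 0 <= \sum_(i < k) w i 0 ^+ 2.
  by apply: sumr_ge0 => i _; exact: sqr_ge0.
apply/idP/eqP => [|->]; last first.
  by rewrite /norm2 big1 ?sqrtr0 // => i _; rewrite mxE expr0n.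
rewrite sqrtr_eq0 => v_le0; apply/colP => i; rewrite mxE.
have /eqP : \sum_(i < k) v i 0 ^+ 2 = 0 by apply/le_anti; rewrite v_le0 sq_ge0.
rewrite psumr_eq0 => [/allP/(_ i)|j _]; last exact: sqr_ge0.
by rewrite mem_index_enum sqrf_eq0 => /(_ isT)/eqP.
Qed.

(** The factor in the lower bound [(1 - eps) |y|^2 <= |S y|^2] is positive. *)
Lemma subspace_embedding_eq0 (R : realType) (m n k : nat) (eps : R)
    (S : 'M[R]_(m, n)) (B : 'M[R]_(n, k)) (z : 'cV[R]_k) :
  eps < 1 -> subspace_embedding eps S B -> S *m (B *m z) = 0 -> B *m z = 0.
Proof.
move=> eps1 emb SBz0; apply/eqP; rewrite -norm2_eq0 -sqrf_eq0 eq_le sqr_ge0.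
have /andP[+ _] := emb (B *m z) (ex_intro _ z erefl).
have /eqP -> : norm2 (S *m (B *m z)) == 0 by rewrite norm2_eq0 SBz0.
by rewrite expr0n /= pmulr_rle0 ?subr_gt0 // => ->.
Qed.

Lemma subspace_embedding_lsub (R : realType) (m n k l : nat) (eps : R)
    (S : 'M[R]_(m, n)) (B : 'M[R]_(n, k)) (C : 'M[R]_(n, l)) :
  subspace_embedding eps S (row_mx B C) -> subspace_embedding eps S B.
Proof.
move=> emb y [z ->]; apply: emb; exists (col_mx z 0).
by rewrite mul_row_col mulmx0 addr0.
Qed.

(** The zero rows of the middle factor erase [Q2]. *)
Lemma rank_revealing_factE (R : realType) (m d p : nat)
    (M : 'M[R]_(m, d)) (Q1 : 'M[R]_(m, p)) (Q2 : 'M[R]_(m, d - p))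
    (R11 : 'M[R]_p) (R12 : 'M[R]_(p, d - p))
    (V1 : 'M[R]_(d, p)) (V2 : 'M[R]_(d, d - p)) :
  rank_revealing_fact M Q1 Q2 R11 R12 V1 V2 ->
  M = Q1 *m (row_mx R11 R12 *m (row_mx V1 V2)^T).
Proof.
move=> fact; rewrite (fact_eq fact) mul_row_block !mulmx0 !addr0.
by rewrite -mul_mx_row mulmxA.
Qed.

(** Orthogonality of [(V1 V2)] gives [(V1 V2)^T V1 = (1; 0)], which selects
    [R11] from [(R11 R12)]. *)
Lemma rank_revealing_precond (R : realType) (m d p : nat)
    (M : 'M[R]_(m, d)) (Q1 : 'M[R]_(m, p)) (Q2 : 'M[R]_(m, d - p))
    (R11 : 'M[R]_p) (R12 : 'M[R]_(p, d - p))
    (V1 : 'M[R]_(d, p)) (V2 : 'M[R]_(d, d - p)) :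
  rank_revealing_fact M Q1 Q2 R11 R12 V1 V2 ->
  M *m (V1 *m invmx R11) = Q1.
Proof.
move=> fact; have [VtV _] := fact_V fact.
have VtV1 : (row_mx V1 V2)^T *m V1 = col_mx 1%:M 0.
  move: VtV; rewrite tr_row_mx mul_col_row scalar_mx_block.
  by case/eq_block_mx=> V11 _ V21 _; rewrite mul_col_mx V11 V21.
rewrite (rank_revealing_factE fact) -!mulmxA (mulmxA _ V1) VtV1.
rewrite (mulmxA (row_mx _ _)) mul_row_col mulmx1 mulmx0 addr0.
by rewrite mulmxV ?(fact_R11 fact) // mulmx1.
Qed.

(** Applied to either side with [y = (R11 R12) V^T x], the sketch [S] gives
    [Q1 y]; and [S] is injective on the range of [A]. *)
Lemma sketched_range (R : realType) (m n d p : nat) (eps : R)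
    (A : 'M[R]_(n, d)) (S : 'M[R]_(m, n))
    (Q1 : 'M[R]_(m, p)) (Q2 : 'M[R]_(m, d - p))
    (R11 : 'M[R]_p) (R12 : 'M[R]_(p, d - p))
    (V1 : 'M[R]_(d, p)) (V2 : 'M[R]_(d, d - p)) (x : 'cV[R]_d) :
  eps < 1 -> subspace_embedding eps S A ->
  rank_revealing_fact (S *m A) Q1 Q2 R11 R12 V1 V2 ->
  exists y : 'cV[R]_p, A *m x = A *m V1 *m invmx R11 *m y.
Proof.
move=> eps1 emb fact.
pose y := row_mx R11 R12 *m (row_mx V1 V2)^T *m x.
exists y; apply/eqP; rewrite -!mulmxA -subr_eq0 -mulmxBr; apply/eqP.
apply: subspace_embedding_eq0 eps1 emb _; rewrite mulmxA mulmxBr.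
rewrite (mulmxA V1) (mulmxA _ (V1 *m _)) (rank_revealing_precond fact).
by rewrite (rank_revealing_factE fact) -mulmxA subrr.
Qed.

Theorem theorem8 (R : realType) (m n d r p : nat)
  (A : 'M[R]_(n, d)) (b : 'cV[R]_n) (S : 'M[R]_(m, n)) (eps : R)
  (rank_A : \rank A = r) (dims : (r <= d <= n)%N)
  (eps01 : 0 < eps < 1)
  (embS : subspace_embedding eps S (row_mx A b))
  (Q1 : 'M[R]_(m, p)) (Q2 : 'M[R]_(m, d - p))
  (R11 : 'M[R]_p) (R12 : 'M[R]_(p, d - p))
  (V1 : 'M[R]_(d, p)) (V2 : 'M[R]_(d, d - p))
  (factSA : rank_revealing_fact (S *m A) Q1 Q2 R11 R12 V1 V2)
  (W : 'M[R]_(n, p)) (defW : W = A *m V1 *m invmx R11)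
  (y_star : 'cV[R]_p)
  (min_y : is_minimizer (fun y : 'cV[R]_p => norm2 (W *m y - b)) y_star)
  (y_tau : 'cV[R]_p) (y_tauE : y_tau = y_star)
  (x_tau : 'cV[R]_d) (def_x : x_tau = V1 *m invmx R11 *m y_tau) :
  is_minimizer (fun x : 'cV[R]_d => norm2 (A *m x - b) ^+ 2) x_tau.
Proof.
move=> x; have /andP[_ eps1] := eps01.
have embA := subspace_embedding_lsub embS.
have [y ->] := sketched_range x eps1 embA factSA.
by rewrite def_x y_tauE !mulmxA -defW lerXn2r ?nnegrE ?norm2_ge0 ?min_y.
Qed.
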